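(* Let $d\ge 1$ and $K\ge 2$, let $T_k\in\mathbb{R}^{n_k,d}$ be nonzero matrices and $b_k\in\mathbb{R}^{n_k}$, $k=1,\dots,K$, let $\sigma\colon\mathbb{R}\to\mathbb{R}$ be a stable activation function applied componentwise, and let $\Phi\colon\mathbb{R}^d\to\mathbb{R}^{n_K}$ be the proximal neural network $$\Phi(x) = T_K T_{K-1}^\dagger\, \sigma\bigl(T_{K-1}\cdots T_2^\dagger\,\sigma\bigl(T_2T_1^\dagger\,\sigma(T_1x+b_1)+b_2\bigr)\cdots + b_{K-1}\bigr)+b_K .$$ (i) If for every $k=1,\dots,K-1$ it holds $T_k^*T_k = \|T_k\|^2 I_d$ or $T_kT_k^* = \|T_k\|^2 I_{n_k}$, and if $T_K = I_d$ (so $n_K=d$), then $\Phi$ is $\alpha$-averaged on $\mathbb{R}^d$ with the Euclidean norm, with $\alpha=\frac{K-1}{K}$. (ii) If $T_1\in\mathbb{R}^{n_1,d}$ has full column rank, $\|T_1\|^2\, T_k^*T_k = \|T_k\|^2\, T_1^*T_1$ for $k=1,\dots,K-1$, and $T_K=I_d$, then $\Phi$ is $\alpha$-averaged on $\mathbb{R}^d$ with the norm $\|\cdot\|_{T_1}$, with $\alpha=\frac{K-1}{K}$.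
   Context: $\|T\|$ denotes the spectral norm of a matrix, $T^*$ its transpose, $T^\dagger$ its Moore-Penrose inverse, $I_m$ the $m\times m$ identity matrix. Explicitly, $\Phi(x) = T_K z_{K-1}+b_K$ with $z_0=x$ and $z_k = T_k^\dagger\,\sigma(T_kz_{k-1}+b_k)$ for $k=1,\dots,K-1$. A function $\sigma\colon\mathbb{R}\to\mathbb{R}$ is a stable activation function if it is monotone increasing (non-decreasing), $1$-Lipschitz continuous and satisfies $\sigma(0)=0$; equivalently, $\sigma=\mathrm{prox}_g$ for some proper, convex, lower semi-continuous $g\colon\mathbb{R}\to(-\infty,\infty]$ having $0$ as a minimizer. It acts on vectors componentwise. For nonzero $T\in\mathbb{R}^{n,d}$ the norm $\|\cdot\|_T$ on $\mathbb{R}^d$ is $\|x\|_T = \bigl(\|Tx\|_2^2/\|T\|^2+\|(I_d-T^\dagger T)x\|_2^2\bigr)^{1/2}$; it is induced by an inner product. An operator $\Psi\colon\mathcal{H}\to\mathcal{H}$ on a Hilbert space is $\alpha$-averaged, $\alpha\in(0,1)$, if there is a nonexpansive ($1$-Lipschitz with respect to the norm of $\mathcal{H}$) operator $R\colon\mathcal{H}\to\mathcal{H}$ with $\Psi=\alpha R+(1-\alpha)I_{\mathcal{H}}$. *)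

(* Defs.v *)
From mathcomp Require Import all_boot all_order all_algebra.
From mathcomp Require Import all_classical all_reals.

Set Implicit Arguments.
Unset Strict Implicit.
Unset Printing Implicit Defensive.

Import Order.TTheory GRing.Theory Num.Theory.

Local Open Scope classical_set_scope.
Local Open Scope ring_scope.

(* The norm that MathComp-Analysis puts on matrices is the max norm, not this one. *)
Definition l2norm (R : realType) (n : nat) (x : 'cV[R]_n) : R :=
  Num.sqrt (\sum_(i < n) x i 0 ^+ 2).

Definition spectral_norm (R : realType) (m n : nat) (A : 'M[R]_(m, n)) : R :=
  sup [set l2norm (A *m x) | x in [set x : 'cV[R]_n | l2norm x <= 1]].

(* The four Penrose equations. *)
Definition is_mpinv (R : realType) (m n : nat)
    (A : 'M[R]_(m, n)) (X : 'M[R]_(n, m)) : Prop :=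
  [/\ A *m X *m A = A, X *m A *m X = X,
      (A *m X)^T = A *m X & (X *m A)^T = X *m A].

(* Not MathComp's [pinvmx], which is a one-sided partial inverse only.
   [mpinvP] and [is_mpinv_uniq] show that the default value 0 is never used
   and that the choice is irrelevant. *)
Definition mpinv (R : realType) (m n : nat) (A : 'M[R]_(m, n)) : 'M[R]_(n, m) :=
  xget 0 [set X | is_mpinv A X].

Definition stable_activation (R : realType) (sigma : R -> R) : Prop :=
  [/\ {homo sigma : x y / x <= y},
      forall x y : R, `|sigma x - sigma y| <= `|x - y| &
      sigma 0 = 0].

Definition Tnorm (R : realType) (n d : nat) (T : 'M[R]_(n, d)) (x : 'cV[R]_d) : R :=
  Num.sqrt (l2norm (T *m x) ^+ 2 / spectral_norm T ^+ 2
            + l2norm ((1%:M - mpinv T *m T) *m x) ^+ 2).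

Definition nonexpansive (R : realType) (d : nat) (N : 'cV[R]_d -> R)
    (Q : 'cV[R]_d -> 'cV[R]_d) : Prop :=
  forall x y : 'cV[R]_d, N (Q x - Q y) <= N (x - y).

Definition averaged (R : realType) (d : nat) (N : 'cV[R]_d -> R) (alpha : R)
    (Psi : 'cV[R]_d -> 'cV[R]_d) : Prop :=
  0 < alpha < 1 /\
  exists2 Q : 'cV[R]_d -> 'cV[R]_d, nonexpansive N Q &
    forall x : 'cV[R]_d, Psi x = alpha *: Q x + (1 - alpha) *: x.

(* Layers are numbered from 1: the entries of [n], [T], [b] at index 0 and
   beyond K are never used by [pnn] below. *)
Fixpoint pnn_hidden (R : realType) (d : nat) (sigma : R -> R) (n : nat -> nat)
    (T : forall k : nat, 'M[R]_(n k, d)) (b : forall k : nat, 'cV[R]_(n k))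
    (x : 'cV[R]_d) (k : nat) : 'cV[R]_d :=
  if k is j.+1 then
    mpinv (T j.+1) *m
      map_mx sigma (T j.+1 *m pnn_hidden sigma T b x j + b j.+1)
  else x.

Definition pnn (R : realType) (d : nat) (sigma : R -> R) (n : nat -> nat)
    (T : forall k : nat, 'M[R]_(n k, d)) (b : forall k : nat, 'cV[R]_(n k))
    (K : nat) (x : 'cV[R]_d) : 'cV[R]_(n K) :=
  T K *m pnn_hidden sigma T b x K.-1 + b K.

Section MoorePenrose.
Variable R : realType.

Lemma sum_sqr_mulmx n (v : 'rV[R]_n) : v *m v^T = 0 -> v = 0.
Proof.
move=> /matrixP/(_ 0 0); rewrite !mxE => v0.
have /psumr_eq0P h : \sum_j v 0 j * v^T j 0 = 0 by [].
apply/matrixP => i j; rewrite ord1 mxE; apply/eqP.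
rewrite -[_ == 0]orbb -mulf_eq0; apply/eqP.
have := h (fun k _ => _) j isT; rewrite mxE; apply => k.
by rewrite mxE -expr2 sqr_ge0.
Qed.

Lemma gram_unitmx m n (F : 'M[R]_(m, n)) : row_free F -> F *m F^T \in unitmx.
Proof.
move=> Ffree; rewrite -row_free_unit -kermx_eq0; apply/eqP/row_matrixP => i.
rewrite row0; set v := row i _.
have vG : v *m (F *m F^T) = 0 by rewrite /v -row_mul mulmx_ker row0.
have /sum_sqr_mulmx/eqP : (v *m F) *m (v *m F)^T = 0.
  by rewrite trmx_mul mulmxA -(mulmxA v) vG mul0mx.
by rewrite (mulmx_free_eq0 _ Ffree) => /eqP.
Qed.

Lemma full_rank_mpinv m n r (C : 'M[R]_(m, r)) (F : 'M[R]_(r, n)) :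
  row_full C -> row_free F ->
  is_mpinv (C *m F)
    (F^T *m invmx (F *m F^T) *m invmx (C^T *m C) *m C^T).
Proof.
move=> Cfull Ffree; have GF := gram_unitmx Ffree.
have GC : C^T *m C \in unitmx.
  by rewrite -{2}(trmxK C) gram_unitmx // /row_free mxrank_tr.
set GFi := invmx (F *m F^T); set GCi := invmx (C^T *m C).
have GFiT : GFi^T = GFi by rewrite trmx_inv trmx_mul trmxK.
have GCiT : GCi^T = GCi by rewrite trmx_inv trmx_mul trmxK.
have FK p (B : 'M_(p, r)) : B *m F *m F^T *m GFi = B.
  by rewrite -!mulmxA (mulmxA F) mulmxV // mulmx1.
have CK p (B : 'M_(p, r)) : B *m GCi *m C^T *m C = B.
  by rewrite -!mulmxA mulVmx // mulmx1.
have AX : (C *m F) *m (F^T *m GFi *m GCi *m C^T) = C *m GCi *m C^T.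
  by rewrite !mulmxA FK.
have XA : (F^T *m GFi *m GCi *m C^T) *m (C *m F) = F^T *m GFi *m F.
  by rewrite !mulmxA CK.
split.
- by rewrite AX !mulmxA CK.
- by rewrite XA !mulmxA FK.
- by rewrite AX !trmx_mul GCiT trmxK mulmxA.
- by rewrite XA !trmx_mul GFiT trmxK mulmxA.
Qed.

Lemma mpinvP m n (A : 'M[R]_(m, n)) : is_mpinv A (mpinv A).
Proof.
apply: xgetPex => /=.
have := full_rank_mpinv (col_base_full A) (row_base_free A).
by rewrite mulmx_base => h; eexists; exact: h.
Qed.

Lemma is_mpinv_uniq m n (A : 'M[R]_(m, n)) (X Y : 'M[R]_(n, m)) :
  is_mpinv A X -> is_mpinv A Y -> X = Y.
Proof.
move=> [X1 X2 X3 X4] [Y1 Y2 Y3 Y4].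
have AXY : A *m X = A *m Y.
  rewrite -X3 -{1}Y1 -(mulmxA (A *m Y)) trmx_mul X3 Y3 mulmxA X1.
  by [].
have XYA : X *m A = Y *m A.
  rewrite -X4 -{1}Y1 -(mulmxA A) mulmxA trmx_mul X4 Y4 -mulmxA (mulmxA A) X1.
  by [].
by rewrite -X2 XYA -mulmxA AXY mulmxA Y2.
Qed.

End MoorePenrose.

Section SpectralNorm.
Variable R : realType.

Lemma l2norm_ge0 n (x : 'cV[R]_n) : 0 <= l2norm x.
Proof. exact: sqrtr_ge0. Qed.

Lemma l2normZ n (a : R) (x : 'cV[R]_n) : l2norm (a *: x) = `|a| * l2norm x.
Proof.
rewrite /l2norm -sqrtr_sqr -sqrtrM ?sqr_ge0 // mulr_sumr.
by congr Num.sqrt; apply: eq_bigr => i _; rewrite mxE exprMn.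
Qed.

Lemma l2norm_eq0 n (x : 'cV[R]_n) : l2norm x = 0 -> x = 0.
Proof.
move=> /eqP; rewrite sqrtr_eq0 => h.
have h0 : \sum_(i < n) x i 0 ^+ 2 = 0.
  by apply/eqP; rewrite eq_le h sumr_ge0 // => i _; exact: sqr_ge0.
apply/matrixP => i j; rewrite ord1 mxE; apply/eqP; rewrite -sqrf_eq0; apply/eqP.
by move/psumr_eq0P: h0 => -> // k _; exact: sqr_ge0.
Qed.

Lemma l2norm_coord n (x : 'cV[R]_n) i : `|x i 0| <= l2norm x.
Proof.
rewrite -sqrtr_sqr ler_wsqrtr // (bigD1 i) //= lerDl.
by apply: sumr_ge0 => j _; exact: sqr_ge0.
Qed.

Lemma spectral_norm_has_sup m n (A : 'M[R]_(m, n)) :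
  has_sup [set l2norm (A *m x) | x in [set x : 'cV[R]_n | l2norm x <= 1]].
Proof.
split.
  exists (l2norm (A *m 0)), 0 => //=.
  by rewrite /l2norm big1 ?sqrtr0 // => i _; rewrite mxE expr0n.
exists (Num.sqrt (\sum_(i < m) (\sum_(j < n) `|A i j|) ^+ 2)) => _ [x /= x1 <-].
apply: ler_wsqrtr; apply: ler_sum => i _; rewrite -real_normK ?num_real //.
rewrite lerXn2r ?nnegrE ?sumr_ge0 // mxE (le_trans (ler_norm_sum _ _ _)) //.
apply: ler_sum => j _; rewrite normrM ler_piMr //.
exact: le_trans (l2norm_coord x j) x1.
Qed.

Lemma spectral_norm_bound m n (A : 'M[R]_(m, n)) (x : 'cV[R]_n) :
  l2norm (A *m x) <= spectral_norm A * l2norm x.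
Proof.
have [x0|x0] := eqVneq (l2norm x) 0.
  rewrite x0 (l2norm_eq0 x0) mulmx0 mulr0 /l2norm big1 ?sqrtr0 // => i _.
  by rewrite mxE expr0n.
have xp : 0 < l2norm x by rewrite lt_def x0 l2norm_ge0.
rewrite -ler_pdivrMr // mulrC -{1}(ger0_norm (l2norm_ge0 x)) -normfV -l2normZ.
rewrite scalemxAr; apply: ub_le_sup; first by case: (spectral_norm_has_sup A).
exists ((l2norm x)^-1 *: x) => //=.
by rewrite l2normZ normfV (ger0_norm (l2norm_ge0 x)) mulVf.
Qed.

End SpectralNorm.

(* Main.v *)
Require Import Defs.
From mathcomp Require Import all_boot all_order all_algebra.
From mathcomp Require Import all_classical all_reals.
From mathcomp Require Import ring lra.

(** Averagedness of a map P with constant m / (m + 1), for a Euclidean seminorm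
    N x = |L x|, is a single quadratic inequality on differences
    u = x - y and v = P x - P y ([average_ineq]):
    m N(v)^2 + N(u - v)^2 <= m N(u)^2. In this form the constants
    compose well: a map with constant m followed by one with constant 1 (a firmly
    nonexpansive map) satisfies the inequality with constant m + 1
    ([average_ineq_comp]), because
    |a + b|^2 <= (m + 1) (|a|^2 + |b|^2 / m). Hence K - 1 firmly nonexpansive
    layers compose to a (K - 1) / K-averaged map, and as T_K = I the last layer
    only adds a translation.

    It remains to see that a layer x |-> T^+ sigma (T x + b), where T^+ is the
    Moore-Penrose inverse, is firmly nonexpansive in the metric G = L^T L. A monotone
    1-Lipschitz sigma gives |s|^2 <= <s, T u> for the difference s of the two
    activations. Both parts of the theorem provide the same compatibility between
    layer and metric, namely (T^+)^T G = c T with c >= 0 ([layer_firm]). It turns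
    <T^+ s, u>_G into c <s, T u> and <T^+ s, T^+ s>_G into c <s, T T^+ s>, and
    the latter is at most c |s|^2 because T T^+ is an orthogonal projection.
    - In part (i), L = I and T^+ = T^T / |T|^2.
    - In part (ii), full column rank makes T_1^+ T_1 = I, so the norm is
      |T_1 x| / |T_1| and L = T_1 / |T_1|; the Gram matrices are proportional,
      so L^T L = T_k^T T_k / |T_k|^2 for every layer k, and
      (T^+)^T T^T T = T T^+ T = T. *)

Set Implicit Arguments.
Unset Strict Implicit.
Unset Printing Implicit Defensive.

Import Order.TTheory GRing.Theory Num.Theory.

Local Open Scope ring_scope.

(** * The Euclidean inner product on column vectors *)

Definition cdot (R : realType) (p : nat) (a b : 'cV[R]_p) : R := (a^T *m b) 0 0.

Section InnerProduct.
Variable R : realType.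
Implicit Types p q : nat.

Lemma cdotE p (a b : 'cV[R]_p) : cdot a b = \sum_i a i 0 * b i 0.
Proof. by rewrite /cdot mxE; apply: eq_bigr => i _; rewrite mxE. Qed.

Lemma l2norm_sqr p (a : 'cV[R]_p) : l2norm a ^+ 2 = cdot a a.
Proof.
rewrite sqr_sqrtr ?sumr_ge0 // => [|i _]; last exact: sqr_ge0.
by rewrite cdotE; apply: eq_bigr => i _; rewrite expr2.
Qed.

Lemma cdot_ge0 p (a : 'cV[R]_p) : 0 <= cdot a a.
Proof. by rewrite -l2norm_sqr sqr_ge0. Qed.

Lemma cdotC p (a b : 'cV[R]_p) : cdot a b = cdot b a.
Proof. by rewrite !cdotE; apply: eq_bigr => i _; rewrite mulrC. Qed.

Lemma cdotBr p (a b c : 'cV[R]_p) : cdot a (b - c) = cdot a b - cdot a c.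
Proof. by rewrite /cdot mulmxBr !mxE. Qed.

Lemma cdotBl p (a b c : 'cV[R]_p) : cdot (a - b) c = cdot a c - cdot b c.
Proof. by rewrite cdotC cdotBr !(cdotC c). Qed.

Lemma cdotZr p (k : R) (a b : 'cV[R]_p) : cdot a (k *: b) = k * cdot a b.
Proof. by rewrite /cdot -scalemxAr mxE. Qed.

Lemma cdotZl p (k : R) (a b : 'cV[R]_p) : cdot (k *: a) b = k * cdot a b.
Proof. by rewrite cdotC cdotZr cdotC. Qed.

Lemma cdot_mulmxl p q (A : 'M[R]_(q, p)) (a : 'cV[R]_p) (b : 'cV[R]_q) :
  cdot (A *m a) b = cdot a (A^T *m b).
Proof. by rewrite /cdot trmx_mul mulmxA. Qed.

Lemma cdot_proj_le p (P : 'M[R]_p) (s : 'cV[R]_p) :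
  P^T = P -> P *m P = P -> cdot s (P *m s) <= cdot s s.
Proof.
move=> PT PP.
(* For an orthogonal projection the gap is |s - P s|^2. *)
have PsPs : cdot (P *m s) (P *m s) = cdot s (P *m s).
  by rewrite cdot_mulmxl PT mulmxA PP.
have := cdot_ge0 (s - P *m s).
by rewrite !cdotBl !cdotBr PsPs (cdotC (P *m s) s); lra.
Qed.

(** The columns of A are the images of the basis vectors, so they vanish with the
    operator norm. *)
Lemma spectral_norm_neq0 m p (A : 'M[R]_(m, p)) : A != 0 -> spectral_norm A != 0.
Proof.
apply: contra_neq => A0; apply/matrixP => i j.
have /matrixP/(_ i 0) : A *m delta_mx j (0 : 'I_1) = 0.
  apply: l2norm_eq0; apply/eqP; rewrite eq_le l2norm_ge0 andbT.
  by have := spectral_norm_bound A (delta_mx j 0); rewrite A0 mul0r.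
by rewrite -colE !mxE.
Qed.

End InnerProduct.

(** * Averaged maps through a quadratic inequality *)

(** For m > 0 this says that P is m / (m + 1)-averaged for the seminorm |L x|;
    for m = 1, that P is firmly nonexpansive. *)
Definition average_ineq (R : realType) (d p : nat) (L : 'M[R]_(p, d)) (m : nat)
    (P : 'cV[R]_d -> 'cV[R]_d) : Prop :=
  forall x y, let u := L *m (x - y) in let v := L *m (P x - P y) in
  m%:R * cdot v v + cdot (u - v) (u - v) <= m%:R * cdot u u.

Section Averaged.
Variables (R : realType) (d p : nat) (L : 'M[R]_(p, d)).

(** The residual u - w of the composition splits as (u - v) + (v - w), and the
    weighted triangle inequality with weight m matches the two hypotheses. The
    divisions by m in it are why m = 0 is excluded. *)
Lemma average_ineq_comp m (P F : 'cV[R]_d -> 'cV[R]_d) : (0 < m)%N ->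
  average_ineq L m P -> average_ineq L 1 F -> average_ineq L m.+1 (F \o P).
Proof.
move=> m_gt0 hP hF x y /=; have := hP x y; have := hF (P x) (P y) => /=.
set u := L *m (x - y); set v := L *m (P x - P y).
set w := L *m (F (P x) - F (P y)).
have m0 : 0 < m%:R :> R by rewrite ltr0n.
(* This square is m times the gap in
   |a + b|^2 <= (m + 1) (|a|^2 + |b|^2 / m) for a = v - w, b = u - v. *)
have := cdot_ge0 (m%:R *: (v - w) - (u - v)).
rewrite -[m.+1]addn1 natrD.
rewrite !(cdotBl, cdotBr, cdotZl, cdotZr) (cdotC v u) (cdotC w u) (cdotC w v).
move: (cdot u u) (cdot u v) (cdot u w) (cdot v v) (cdot v w) (cdot w w) (m%:R) m0.
move=> uu uv uw vv vw ww r r0 sq hw hv.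
rewrite -(ler_pM2l r0) -subr_ge0.
have hw' : 0 <= r * (r + 1) * (1 * vv - (1 * ww + (vv - vw - (vw - ww)))).
  by rewrite mulr_ge0 ?subr_ge0 //; nra.
have hv' : 0 <= (r + 1) * (r * uu - (r * vv + (uu - uv - (uv - vv)))).
  by rewrite mulr_ge0 ?subr_ge0 //; lra.
nra.
Qed.

(** The residual map Q is determined by the convex combination; its
    nonexpansiveness is the quadratic inequality rewritten by polarization. *)
Lemma average_ineq_averaged m (N : 'cV[R]_d -> R) (P : 'cV[R]_d -> 'cV[R]_d) :
  (0 < m)%N -> (forall x, N x = l2norm (L *m x)) -> average_ineq L m P ->
  averaged N ((m.+1%:R - 1) / m.+1%:R) P.
Proof.
move=> m_gt0 NE hP; have m0 : 0 < m%:R :> R by rewrite ltr0n.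
have -> : m.+1%:R - 1 = m%:R :> R by rewrite -natr1 addrK.
rewrite -natr1; set a := m%:R / _.
have a0 : 0 < a by rewrite divr_gt0 // addr_gt0.
have am : a * (m%:R + 1) = m%:R by rewrite /a; field; lra.
split.
  by rewrite a0 /= /a ltr_pdivrMr ?mul1r ?ltrDl // addr_gt0.
exists (fun x => a^-1 *: (P x - (1 - a) *: x)) => [x y|x]; last first.
  by rewrite scalerA divff ?gt_eqF // scale1r subrK.
rewrite !NE -ler_sqr ?nnegrE ?l2norm_ge0 // !l2norm_sqr.
have -> : L *m (a^-1 *: (P x - (1 - a) *: x) - a^-1 *: (P y - (1 - a) *: y))
        = a^-1 *: (L *m (P x - P y) - (1 - a) *: (L *m (x - y))).
  rewrite -scalerBr -scalemxAr !mulmxBr -!scalemxAr; congr (_ *: _).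
  by rewrite scalerBr opprD addrACA -opprD.
have := hP x y => /=; set u := L *m (x - y); set v := L *m (P x - P y).
rewrite cdotZl cdotZr mulrA -invfM.
rewrite ler_pdivrMl; last exact: mulr_gt0.
rewrite !(cdotBl, cdotBr, cdotZl, cdotZr) (cdotC v u).
move: (cdot u u) (cdot u v) (cdot v v) (m%:R) m0 am => uu uv vv r r0 ar h.
(* With the weight a = m / (m + 1), the claim is the quadratic inequality
   divided by m + 1. *)
have c0 : 0 < r + 1 by lra.
have aE : a = r / (r + 1) by rewrite -[X in X / _]ar mulfK // gt_eqF.
have rr0 : r + 1 != 0 by rewrite gt_eqF.
rewrite -subr_ge0; set gap := (X in 0 <= X).
have -> : gap = (r + 1)^-1 * (r * uu - (r * vv + (uu - uv - (uv - vv)))).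
  by rewrite /gap aE; field.
by rewrite mulr_ge0 ?subr_ge0 // invr_ge0 ltW.
Qed.

End Averaged.

(** * Firm nonexpansiveness of a layer *)

Section Layer.
Variables (R : realType) (sigma : R -> R).
Hypothesis hsigma : stable_activation sigma.

(** By monotonicity the increments of sigma and of its argument have the same
    sign, so the Lipschitz bound survives multiplication by the former. *)
Lemma stable_activation_firm (x y : R) :
  (sigma x - sigma y) ^+ 2 <= (sigma x - sigma y) * (x - y).
Proof.
case: hsigma => mono lip _; wlog yx : x y / y <= x => [th|].
  have [/th//|/ltW/th] := leP y x.
  by rewrite -(opprB (sigma x)) -(opprB x) sqrrN mulrNN.
have syx := mono _ _ yx; have := lip x y.
by rewrite !ger0_norm ?subr_ge0 // expr2 => h; rewrite ler_wpM2l ?subr_ge0.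
Qed.

Lemma cdot_map_stable_firm p (a b : 'cV[R]_p) :
  let s := map_mx sigma a - map_mx sigma b in cdot s s <= cdot s (a - b).
Proof.
rewrite /= !cdotE; apply: ler_sum => i _.
by rewrite !mxE -expr2 stable_activation_firm.
Qed.

(** The compatibility condition moves the metric L^T L past the pseudo-inverse:
    <L A^+ s, L w> = c <s, A w> for every w. Taking w = x - y and w = A^+ s
    reduces firm nonexpansiveness of the layer to that of sigma, because
    A A^+ is an orthogonal projection. *)
Lemma layer_firm q d p (A : 'M[R]_(q, d)) (b : 'cV[R]_q) (L : 'M[R]_(p, d)) (c : R) :
  0 <= c -> (mpinv A)^T *m (L^T *m L) = c *: A ->
  average_ineq L 1 (fun x => mpinv A *m map_mx sigma (A *m x + b)).
Proof.
move=> c0 hc x y /=; have [AXA _ AXT _] := mpinvP A.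
have := cdot_map_stable_firm (A *m x + b) (A *m y + b) => /=.
rewrite -mulmxBr; set s := map_mx _ _ - map_mx _ _.
have -> : A *m x + b - (A *m y + b) = A *m (x - y).
  by rewrite opprD addrACA subrr addr0 mulmxBr.
set z := x - y => sz.
have dotG w : cdot (L *m (mpinv A *m s)) (L *m w) = c * cdot s (A *m w).
  by rewrite !cdot_mulmxl (mulmxA L^T) mulmxA hc -scalemxAl cdotZr.
have proj : cdot s (A *m (mpinv A *m s)) <= cdot s s.
  by rewrite mulmxA cdot_proj_le // mulmxA AXA.
have : c * cdot s (A *m (mpinv A *m s)) <= c * cdot s (A *m z).
  by rewrite ler_wpM2l // (le_trans proj).
rewrite -!dotG cdotBl !cdotBr (cdotC (L *m z) (L *m (mpinv A *m s))); lra.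
Qed.

End Layer.

(** * The Moore-Penrose inverse in the two settings *)

Lemma mpinv_scaled_isometry (R : realType) (m d : nat) (A : 'M[R]_(m, d)) (t : R) :
  t != 0 -> A^T *m A = t%:M \/ A *m A^T = t%:M -> mpinv A = t^-1 *: A^T.
Proof.
move=> t0 hA; apply: is_mpinv_uniq (mpinvP A) _.
split; rewrite -?scalemxAl -?scalemxAr -?scalemxAl.
- case: hA => h; [rewrite -mulmxA h mul_mx_scalar | rewrite h mul_scalar_mx];
  by rewrite scalerA mulVf // scale1r.
- case: hA => h; [rewrite h mul_scalar_mx | rewrite -mulmxA h mul_mx_scalar];
  by rewrite !scalerA mulVf // mulr1.
- by rewrite linearZ /= trmx_mul trmxK.
- by rewrite linearZ /= trmx_mul trmxK.
Qed.

Lemma mpinv_full_column_rank (R : realType) (m d : nat) (A : 'M[R]_(m, d)) :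
  \rank A = d -> mpinv A *m A = 1%:M.
Proof.
move=> rA; have [AXA _ _ _] := mpinvP A.
have fA : row_full A by rewrite /row_full rA.
by apply: (row_full_inj fA); rewrite mulmxA AXA mulmx1.
Qed.

(** Injectivity of A kills the component of the norm on the kernel. What
    remains is a Euclidean seminorm of the form |L x|. *)
Lemma Tnorm_full_column_rank (R : realType) (m d : nat) (A : 'M[R]_(m, d))
    (x : 'cV[R]_d) : \rank A = d ->
  Tnorm A x = l2norm (((spectral_norm A)^-1 *: A) *m x).
Proof.
move=> rA; rewrite /Tnorm mpinv_full_column_rank // subrr mul0mx -exprVn.
have -> : l2norm (0 : 'cV[R]_d) = 0.
  by rewrite /l2norm big1 ?sqrtr0 // => i _; rewrite mxE expr0n.
rewrite expr0n addr0 -exprMn sqrtr_sqr normrM ger0_norm ?l2norm_ge0 //.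
by rewrite -scalemxAl l2normZ mulrC.
Qed.

(** * Composing the layers *)

(** The last layer, whose weight matrix is I, is a translation. Its output dimension q
    is only propositionally equal to d, hence the casts. *)
Lemma castmx_affine (R : realType) (q d : nat) (hq : q = d) (A : 'M[R]_(q, d))
    (c : 'cV[R]_q) (x : 'cV[R]_d) : castmx (hq, erefl d) A = 1%:M ->
  castmx (hq, erefl 1%N) (A *m x + c) = x + castmx (hq, erefl 1%N) c.
Proof. by case: d / hq A x => A x; rewrite !castmx_id => ->; rewrite mul1mx. Qed.

Section Network.
Variables (R : realType) (d p : nat) (L : 'M[R]_(p, d)).
Variables (sigma : R -> R) (n : nat -> nat).
Variables (T : forall k, 'M[R]_(n k, d)) (b : forall k, 'cV[R]_(n k)).

Lemma pnn_hidden_average_ineq m : stable_activation sigma ->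
  (forall k, (1 <= k <= m.+1)%N -> exists2 c, 0 <= c &
     (mpinv (T k))^T *m (L^T *m L) = c *: T k) ->
  average_ineq L m.+1 (fun x => pnn_hidden sigma T b x m.+1).
Proof.
move=> hsigma; elim: m => [|m IH] hL.
  have [c c0 hc] := hL 1%N isT.
  exact: (layer_firm hsigma (b 1%N) c0 hc).
have [c c0 hc] := hL m.+2 (leqnn _).
apply: (average_ineq_comp _ _ (layer_firm hsigma (b m.+2) c0 hc)) => //.
by apply: IH => k /andP[k1 km]; apply: hL; rewrite k1 ltnW.
Qed.

(** A single metric L has to be compatible with all the hidden layers, since
    averagedness composes only within one norm. *)
Lemma pnn_averaged K (hn : n K = d) (N : 'cV[R]_d -> R) :
  (2 <= K)%N -> stable_activation sigma ->
  (forall x, N x = l2norm (L *m x)) ->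
  (forall k, (1 <= k <= K.-1)%N -> exists2 c, 0 <= c &
     (mpinv (T k))^T *m (L^T *m L) = c *: T k) ->
  castmx (hn, erefl d) (T K) = 1%:M ->
  averaged N ((K%:R - 1) / K%:R)
    (fun x => castmx (hn, erefl 1%N) (pnn sigma T b K x)).
Proof.
case: K hn => [|[|m]] // hn _ hsigma NE hL TK.
apply: (average_ineq_averaged _ NE) => // x y.
have hidE z : castmx (hn, erefl 1%N) (pnn sigma T b m.+2 z)
    = pnn_hidden sigma T b z m.+1 + castmx (hn, erefl 1%N) (b m.+2).
  exact: castmx_affine.
rewrite !hidE opprD addrACA subrr addr0.
exact: (pnn_hidden_average_ineq hsigma hL x y).
Qed.

End Network.

Theorem lemma5p3 (R : realType) (d K : nat) (hd : (1 <= d)%N) (hK : (2 <= K)%N)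
    (n : nat -> nat)
    (T : forall k : nat, 'M[R]_(n k, d)) (b : forall k : nat, 'cV[R]_(n k))
    (hT : forall k : nat, (1 <= k <= K)%N -> T k != 0)
    (sigma : R -> R) (hsigma : stable_activation sigma) :
  (forall hn : n K = d,
     (forall k : nat, (1 <= k <= K.-1)%N ->
        (T k)^T *m T k = (spectral_norm (T k) ^+ 2)%:M \/
        T k *m (T k)^T = (spectral_norm (T k) ^+ 2)%:M) ->
     castmx (hn, erefl d) (T K) = 1%:M ->
     averaged (@l2norm R d) ((K%:R - 1) / K%:R)
       (fun x => castmx (hn, erefl 1%N) (pnn sigma T b K x)))
  /\
  (forall hn : n K = d,
     \rank (T 1%N) = d ->
     (forall k : nat, (1 <= k <= K.-1)%N ->
        spectral_norm (T 1%N) ^+ 2 *: ((T k)^T *m T k) =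
        spectral_norm (T k) ^+ 2 *: ((T 1%N)^T *m T 1%N)) ->
     castmx (hn, erefl d) (T K) = 1%:M ->
     averaged (Tnorm (T 1%N)) ((K%:R - 1) / K%:R)
       (fun x => castmx (hn, erefl 1%N) (pnn sigma T b K x))).
Proof.
have spectral2_gt0 k : (1 <= k <= K)%N -> 0 < spectral_norm (T k) ^+ 2.
  by move=> hk; rewrite exprn_even_gt0 //= spectral_norm_neq0 ?hT.
have inner k : (1 <= k <= K.-1)%N -> (1 <= k <= K)%N.
  by case/andP=> -> /leq_trans -> //; exact: leq_pred.
split=> hn.
  move=> hiso; apply: (@pnn_averaged _ _ _ 1%:M) => // [x|k hk].
    by rewrite mul1mx.
  (* c = 1 / |T_k|^2, in both parts. *)
  have t0 := spectral2_gt0 _ (inner _ hk).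
  exists (spectral_norm (T k) ^+ 2)^-1; first by rewrite invr_ge0 ltW.
  rewrite (mpinv_scaled_isometry _ (hiso k hk)) ?gt_eqF //.
  by rewrite trmx1 !mulmx1 linearZ /= trmxK.
move=> rT1 hgram.
apply: (@pnn_averaged _ _ _ ((spectral_norm (T 1%N))^-1 *: T 1%N)) => // [x|k hk].
  exact: Tnorm_full_column_rank.
have t0 := spectral2_gt0 _ (inner _ hk).
have t1 : 0 < spectral_norm (T 1%N) ^+ 2 by exact: (spectral2_gt0 1%N (ltnW hK)).
exists (spectral_norm (T k) ^+ 2)^-1; first by rewrite invr_ge0 ltW.
(* By proportionality of the Gram matrices, the metric looks the same from
   every layer. *)
have -> : ((spectral_norm (T 1%N))^-1 *: T 1%N)^T
            *m ((spectral_norm (T 1%N))^-1 *: T 1%N)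
        = (spectral_norm (T k) ^+ 2)^-1 *: ((T k)^T *m T k).
  rewrite -scalemxAr linearZ /= -scalemxAl scalerA -expr2 exprVn.
  apply: (scalerI (lt0r_neq0 t0)); rewrite scalerA mulrC -scalerA -hgram //.
  by rewrite !scalerA mulVf ?mulfV ?gt_eqF.
have [AXA _ AXT _] := mpinvP (T k).
by rewrite -scalemxAr mulmxA -trmx_mul AXT AXA.
Qed.
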